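(* Let $\omega\in\Omega$ and $y'\in Y$. Then the monotonic cut $$\theta_\omega \;\geq\; f_\omega(y')\left(1-\sum_{j\in[n]}\ \sum_{\xi=y_j'+1}^{y_{\max}} z_{j\xi}\right)$$ is a valid Benders optimality cut on $(\omega,y')$. That is, writing $z_{j\xi}(y)=1$ if $y_j=\xi$ and $z_{j\xi}(y)=0$ otherwise, for every $y\in Y$ we have $$f_\omega(y)\;\geq\; f_\omega(y')\left(1-\sum_{j\in[n]}\ \sum_{\xi=y_j'+1}^{y_{\max}} z_{j\xi}(y)\right),$$ and equality holds at $y=y'$.
   Context: Let $n$ be a positive integer, $[n]=\{1,\dots,n\}$, and let $y_{\min}\le y_{\max}$ be non-negative integers. The problem considered is $$\min_y\ g(y)+\sum_{\omega\in\Omega}f_\omega(y)\quad\text{subject to } y\in Y,$$ where $\Omega$ is a finite set, $Y\subseteq\{y_{\min},\dots,y_{\max}\}^n\subseteq\mathbb{Z}_+^n$ is a finite set, $g:\mathbb{Z}_+^n\to\mathbb{R}$ is a function, and for each $\omega\in\Omega$, $f_\omega:\mathbb{Z}_+^n\to\mathbb{R}_+$ is a bounded function that is non-increasing in each of the variables ($\mathbb{Z}_+$, $\mathbb{R}_+$ denote the non-negative integers and reals). In the master problem, each $f_\omega(y)$ is replaced by a continuous variable $\theta_\omega$, and binary variables $z_{j\xi}$ ($j\in[n]$, $\xi\in\{y_{\min},\dots,y_{\max}\}$) are introduced with $z_{j\xi}=1$ if and only if $y_j=\xi$, via the constraints $\sum_{\xi} z_{j\xi}=1$ and $\sum_\xi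 \xi z_{j\xi}=y_j$ for all $j\in[n]$. A Benders optimality cut on $(\omega,y')$ is an inequality $\theta_\omega\ge B(y)$ such that $B(y)\le f_\omega(y)$ for all $y\in Y$, with equality at $y=y'$. Empty sums are zero. *)

(* Defs.v *)
From mathcomp Require Import all_boot all_order all_algebra finmap reals.

Set Implicit Arguments.
Unset Strict Implicit.
Unset Printing Implicit Defensive.

Import Order.TTheory GRing.Theory Num.Theory.
Local Open Scope ring_scope.

(* Points of Z_+^n; the coordinate index j in {1, .., n} is shifted to 'I_n. *)
Notation point n := {ffun 'I_n -> nat}.

Definition bounded_on_points (R : realType) (n : nat) (f : point n -> R) : Prop :=
  exists M : R, forall y : point n, `|f y| <= M.

Definition nonincreasing_in_each (R : realType) (n : nat)
    (f : point n -> R) : Prop :=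
  forall (j : 'I_n) (x y : point n),
    (forall i : 'I_n, i != j -> x i = y i) -> (x j <= y j)%N -> f y <= f x.

Definition z_of (R : realType) (n : nat) (y : point n) (j : 'I_n) (xi : nat) : R :=
  if y j == xi then 1 else 0.

(* The right-hand side of the cut, as a function of the variables z. *)
Definition monotonic_cut (R : realType) (n ymax : nat) (f : point n -> R)
    (y' : point n) (z : 'I_n -> nat -> R) : R :=
  f y' * (1 - \sum_(j < n) \sum_((y' j).+1 <= xi < ymax.+1) z j xi).

(* B is the right-hand side of an optimality cut [theta >= B y] for f at y'. *)
Definition benders_optimality_cut (R : realType) (n : nat) (Y : {fset point n})
    (f : point n -> R) (y' : point n) (B : point n -> R) : Prop :=
  (forall y : point n, y \in Y -> B y <= f y) /\ B y' = f y'.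

(* Main.v *)
Require Import Defs.
From mathcomp Require Import all_boot all_order all_algebra finmap reals.

Set Implicit Arguments.
Unset Strict Implicit.
Unset Printing Implicit Defensive.

Import Order.TTheory GRing.Theory Num.Theory.
Local Open Scope ring_scope.

(** The sum of the z-variables in the cut counts the coordinates in which [y]
    exceeds [y'] ([sum_z_of]).  If there is at least one, the factor of [f y']
    is at most 0, so the cut follows from nonnegativity of [f].  If there is
    none, the factor is 1 and [y] lies below [y'] in every coordinate, so the
    cut follows from monotonicity of [f] ([nonincreasing_pointwise]).  The point
    [y'] itself is in the second case, which gives the equality. *)

(** The points agreeing with [y] on the coordinates below [k] and with [x] on
    the others form a path from [x] to [y] that changes one coordinate at a
    time, and [f] does not increase along it. *)
Lemma nonincreasing_pointwise (R : realType) (n : nat) (f : point n -> R) :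
  nonincreasing_in_each f ->
  forall x y : point n, (forall j, (x j <= y j)%N) -> f y <= f x.
Proof.
move=> f_mono x y le_xy.
pose h k : point n := [ffun i : 'I_n => if (i < k)%N then y i else x i].
have h_le k : (k <= n)%N -> f (h k) <= f x.
  elim: k => [|k IHk] ltkn.
    by rewrite (_ : h 0 = x) //; apply/ffunP => i; rewrite ffunE.
  apply: le_trans (IHk (ltnW ltkn)).
  apply: (f_mono (Ordinal ltkn)) => [i neq_ik|]; rewrite !ffunE /=.
    by rewrite [in RHS]ltnS [in RHS]leq_eqVlt -[_ == k :> nat]/(i == Ordinal ltkn)
      (negPf neq_ik).
  by rewrite ltnn ltnSn.
rewrite (_ : y = h n) ?h_le //.
by apply/ffunP => i; rewrite ffunE ltn_ord.
Qed.

Lemma sum_z_of (R : realType) (n : nat) (y : point n) (j : 'I_n) (a b : nat) :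
  \sum_(a <= xi < b) z_of R y j xi = (a <= y j < b)%N%:R.
Proof.
rewrite /z_of -big_mkcond /=.
under eq_bigl do rewrite eq_sym.
by rewrite big_nat1_eq; case: ifP.
Qed.

Lemma monotonic_cut_below (R : realType) (n ymax : nat) (f : point n -> R)
    (y' y : point n) :
  (forall j, (y j <= y' j)%N) -> monotonic_cut ymax f y' (z_of R y) = f y'.
Proof.
move=> le_yy'; rewrite /monotonic_cut big1 ?subr0 ?mulr1 // => j _.
by rewrite sum_z_of ltnNge le_yy'.
Qed.

(** The upper bound on [y j] puts [y j] in the range of summation, so that the
    coordinate [j] contributes 1 to the sum. *)
Lemma monotonic_cut_le0 (R : realType) (n ymax : nat) (f : point n -> R)
    (y' y : point n) (j : 'I_n) :
  0 <= f y' -> (y' j < y j <= ymax)%N ->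
  monotonic_cut ymax f y' (z_of R y) <= 0.
Proof.
move=> f_ge0 y_j; rewrite /monotonic_cut mulr_ge0_le0 // subr_le0.
rewrite (bigD1 j) //= sum_z_of ltnS y_j lerDl sumr_ge0 // => i _.
by rewrite sum_z_of.
Qed.

Theorem mainTheorem1 (R : realType) (n : nat) (n_gt0 : (0 < n)%N)
    (ymin ymax : nat) (ymin_le_ymax : (ymin <= ymax)%N)
    (Omega : finType) (Y : {fset point n})
    (Y_box : forall y : point n, y \in Y ->
       forall j : 'I_n, (ymin <= y j <= ymax)%N)
    (g : point n -> R) (f : Omega -> point n -> R)
    (f_ge0 : forall (w : Omega) (y : point n), 0 <= f w y)
    (f_bounded : forall w : Omega, bounded_on_points (f w))
    (f_mono : forall w : Omega, nonincreasing_in_each (f w))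
    (omega : Omega) (y' : point n) (y'_in : y' \in Y) :
  benders_optimality_cut Y (f omega) y'
    (fun y : point n => monotonic_cut ymax (f omega) y' (z_of R y)).
Proof.
split=> [y y_in|]; last exact: monotonic_cut_below.
case: (boolP [forall j, y j <= y' j]%N) => [/forallP le_yy'|].
  by rewrite monotonic_cut_below // nonincreasing_pointwise.
case/forallPn => j; rewrite -ltnNge => lt_y'y.
apply: le_trans (f_ge0 omega y); apply: (@monotonic_cut_le0 _ _ _ _ _ _ j) => //.
by rewrite lt_y'y; case/andP: (Y_box _ y_in j).
Qed.
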